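(* Let $\gamma$ be a triharmonic (i.e. $3$-harmonic) $2$-Frenet curve in an $m$-dimensional semi-Riemannian space form $N^m_t(c)$, $m\ge2$, $1\le t\le m-1$. Then its curvature $k(s)$ is a constant function.
   Context: Conventions. For a semi-Riemannian manifold $(M,\langle\,,\rangle)$ with Levi-Civita connection $\nabla$, $R(X,Y)Z=\nabla_X\nabla_YZ-\nabla_Y\nabla_XZ-\nabla_{[X,Y]}Z$. Curves $\gamma:I\to M$ ($I$ an open real interval) are smooth, nonnull, parametrized by arc length; $T=\gamma'$, $\langle T,T\rangle=\epsilon_1\in\{1,-1\}$. Put $\nabla_T^0T=T$, $\nabla_T^jT=\nabla_T(\nabla_T^{j-1}T)$. A curve is triharmonic if $$\tau_3(\gamma)=\nabla^{5}_T T+R\big(\nabla^{3}_T T,T\big)T-R\big(\nabla^{2}_T T,\nabla_T T\big)T=0.$$ A $2$-Frenet curve is a curve admitting a frame $\{F_1=T,F_2\}$ along it with $\langle F_i,F_i\rangle=\epsilon_i=\pm1$, $\langle F_1,F_2\rangle=0$, and $\nabla_TF_1=\epsilon_2kF_2$, $\nabla_TF_2=-\epsilon_1kF_1$, where the curvature $k(s)$ is a positive smooth function. (If $m=2$ and the manifold is oriented, $k$ is allowed to take any real value, $F_2$ being then fixed by requiring $\{F_1,F_2\}$ to be positively oriented.) Space forms: let $\mathbb{R}^n_t$ be $\mathbb{R}^n$ with $\langle x,y\rangle=-\sum_{i=1}^t x_iy_i+\sum_{i=t+1}^n x_iy_i$. $N^m_t(c)$ denotes $\mathbb{R}^m_t$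 if $c=0$, $\{x\in\mathbb{R}^{m+1}_t:\langle x,x\rangle=1/c\}$ if $c>0$, $\{x\in\mathbb{R}^{m+1}_{t+1}:\langle x,x\rangle=1/c\}$ if $c<0$, with the induced metric of index $t$; its curvature is $R(X,Y)Z=c(\langle Y,Z\rangle X-\langle X,Z\rangle Y)$. *)

(* Defs.v *)
From HB Require Import structures.
From mathcomp Require Import all_boot all_order all_algebra.
From mathcomp Require Import all_classical all_reals all_analysis.
Import Order.TTheory GRing.Theory Num.Theory.
Import numFieldNormedType.Exports.

Set Implicit Arguments.
Unset Strict Implicit.
Unset Printing Implicit Defensive.

Local Open Scope ring_scope.
Local Open Scope classical_set_scope.

(* The scalar product of R^n_t: the first t coordinates are the negative
   ones. *)
Definition sprod (R : realType) (n t : nat) (x y : 'rV[R]_n) : R :=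
  \sum_(i < n) (-1) ^+ (i < t)%N * x ord0 i * y ord0 i.

Definition smooth_on (R : realType) (V : normedModType R) (I : set R)
    (f : R -> V) : Prop :=
  forall (n : nat) (s : R), I s -> derivable (derive1n n f) s 1.

(* N^m_t(c) is realized as a subset of R^n_t' with n = ambient_dim m c and
   t' = ambient_index t c. *)
Definition ambient_dim (R : realType) (m : nat) (c : R) : nat :=
  if c == 0 then m else m.+1.

Definition ambient_index (R : realType) (t : nat) (c : R) : nat :=
  if c < 0 then t.+1 else t.

Section SpaceForm.
Variables (R : realType) (m t : nat) (c : R).

Local Notation ambient := 'rV[R]_(ambient_dim m c).

Definition metric (x y : ambient) : R := sprod (ambient_index t c) x y.

Definition space_form : set ambient :=
  [set p | c != 0 -> metric p p = c^-1].

Definition tangent_at (p : ambient) : set ambient :=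
  [set v | c != 0 -> metric p v = 0].

(* For c != 0 the normal line at p is spanned by the position vector p. *)
Definition tangent_proj (p v : ambient) : ambient :=
  if c == 0 then v else v - (metric v p / metric p p) *: p.

(* The Levi-Civita connection of the induced metric is the tangential part of
   the flat connection of the ambient space (Gauss formula).  This is the
   induced covariant derivative nabla_T V along g, where T is the velocity of
   g and V is a vector field along g. *)
Definition cov_deriv (g V : R -> ambient) : R -> ambient :=
  fun s => tangent_proj (g s) (derive1 V s).

Definition velocity (g : R -> ambient) : R -> ambient := derive1 g.

Definition cov_deriv_velocity (j : nat) (g : R -> ambient) : R -> ambient :=
  iter j (cov_deriv g) (velocity g).

Definition curvature_tensor (X Y Z : ambient) : ambient :=
  c *: (metric Y Z *: X - metric X Z *: Y).

Definition tau3 (g : R -> ambient) (s : R) : ambient :=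
  let D j := cov_deriv_velocity j g s in
  D 5 + curvature_tensor (D 3) (D 0) (D 0)
      - curvature_tensor (D 2) (D 1) (D 0).

Definition arc_length_curve (I : set R) (e1 : R) (g : R -> ambient) : Prop :=
  [/\ e1 = 1 \/ e1 = -1, smooth_on I g, forall s, I s -> space_form (g s)
    & forall s, I s -> metric (velocity g s) (velocity g s) = e1].

Definition triharmonic (I : set R) (g : R -> ambient) : Prop :=
  forall s, I s -> tau3 g s = 0.

(* Meaningful for m = 2 only.  The surface N^2_t(c) with 1 <= t <= m - 1 is
   connected, hence has exactly two orientations, selected by o: a tangent
   frame (X, Y) at p is positive when, up to the sign fixed by o, det(X, Y) > 0
   if c = 0 and det(p, X, Y) > 0 otherwise. *)
Definition positively_oriented (o : bool) (p X Y : ambient) : Prop :=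
  let rows := if c == 0 then [:: X; Y] else [:: p; X; Y] in
  0 < (-1) ^+ o * \det (\matrix_(i < ambient_dim m c) nth 0 rows i).

(* If m = 2, k may take any real value provided the frame {T, F2} is positive
   for the chosen orientation o; otherwise k is positive. *)
Definition two_frenet_curve (o : bool) (I : set R) (e1 e2 : R)
    (g F2 : R -> ambient) (k : R -> R) : Prop :=
  let F1 := velocity g in
  [/\ arc_length_curve I e1 g /\ (e2 = 1 \/ e2 = -1),
      smooth_on I F2 /\ (smooth_on I (k : R -> R^o)),
      forall s, I s ->
        [/\ tangent_at (g s) (F2 s), metric (F2 s) (F2 s) = e2
          & metric (F1 s) (F2 s) = 0],
      forall s, I s -> cov_deriv g F1 s = (e2 * k s) *: F2 s /\
                       cov_deriv g F2 s = (- e1 * k s) *: F1 s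
    & (forall s, I s -> 0 < k s) \/
      (m = 2%N /\ forall s, I s -> positively_oriented o (g s) (F1 s) (F2 s))].

End SpaceForm.

Arguments triharmonic {R m} t c I g.
Arguments two_frenet_curve {R m} t c o I e1 e2 g F2 k.

(* The next two lemmas check that tangent_proj is the projection onto the
   tangent space along its orthogonal complement. *)
Section TangentProj.
Variables (R : realType) (m t : nat) (c : R).
Implicit Types p v w : 'rV[R]_(ambient_dim m c).

Let metricC v w : metric t v w = metric t w v.
Proof. by apply: eq_bigr => i _; rewrite -mulrA (mulrC (v _ _)) mulrA. Qed.

Let metricBZ v w (a : R) p :
  metric t p (v - a *: w) = metric t p v - a * metric t p w.
Proof.
rewrite /metric /sprod mulr_sumr -sumrB; apply: eq_bigr => i _.
by rewrite !mxE mulrBr; congr (_ - _); rewrite mulrCA.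
Qed.

Lemma tangent_proj_tangent p v :
  space_form t p -> tangent_at t p (tangent_proj t p v).
Proof.
move=> Np c0; rewrite /tangent_proj (negbTE c0) metricBZ divfK.
  by rewrite metricC subrr.
by rewrite (Np c0) invr_eq0.
Qed.

Lemma tangent_proj_normal p v w :
  tangent_at t p w -> metric t w (v - tangent_proj t p v) = 0.
Proof.
move=> pw; rewrite /tangent_proj; have [c0|c0] := eqVneq c 0.
  by rewrite subrr /metric /sprod big1 // => i _; rewrite mxE mulr0.
have -> : v - (v - (metric t v p / metric t p p) *: p) =
          0 - (- (metric t v p / metric t p p)) *: p.
  by rewrite opprB addrC subrK sub0r scaleNr opprK.
rewrite metricBZ (metricC w p) (pw c0) mulr0 subr0.
by rewrite /metric /sprod big1 // => i _; rewrite mxE mulr0.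
Qed.

End TangentProj.

(* Main.v *)
(* Along the curve, the Frenet equations express each nabla_T^j T in the frame
   (T, F_2), with coefficients polynomial in k and its derivatives.  The two
   components of tau_3 = 0 are an equation of order 3 and one of order 4 for k.
   Where k <> 0 the former has two first integrals, which give k'' and k'^2 as
   rational functions of k; the latter then becomes a nontrivial polynomial
   equation on k, so that k, being continuous, is locally constant.  Hence
   k k' = 0 everywhere, whether or not k vanishes, k^2 is constant, and so is k
   by continuity. *)
Require Import Defs.
From mathcomp Require Import all_boot all_order all_algebra.
From mathcomp Require Import all_classical all_reals all_analysis.
From mathcomp Require Import ring lra.
Import numFieldNormedType.Exports.
Local Open Scope ring_scope.
Local Open Scope classical_set_scope.
Import Order.TTheory GRing.Theory Num.Theory.

(** * Constancy criteria on an interval, and the two scalar equations for the curvature *)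

Lemma derive0_cst_on_interval (R : realType) (J : set R) (f : R -> R) :
  is_interval J -> (forall s, J s -> is_derive s 1 f 0) ->
  forall a b, J a -> J b -> f a = f b.
Proof.
move=> Jitv Df.
suff lt_cst a b : J a -> J b -> a < b -> f a = f b.
  move=> a b Ja Jb; have [ab|ba|->//] := ltgtP a b; first exact: lt_cst.
  by apply/esym; exact: lt_cst.
move=> Ja Jb ab.
have Jab x : a <= x <= b -> J x by exact: Jitv Ja Jb x.
have Dfab x : x \in `]a, b[%R -> is_derive x 1 f 0.
  by rewrite in_itv/= => /andP[ax xb]; apply/Df/Jab; rewrite !ltW.
have cf : {within `[a, b], continuous f}.
  apply: derivable_within_continuous => x; rewrite in_itv/= => /Jab Jx.
  by have [] := Df x Jx.
have [x _] := MVT ab Dfab cf.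
by rewrite mul0r => /eqP; rewrite subr_eq0 => /eqP.
Qed.

(** If [f a] and [f b] differed, the intermediate value theorem would make every value between them
    a root of [p], more roots than a nonzero polynomial can have. *)
Lemma root_valued_cst_on_interval (R : realType) (J : set R) (f : R -> R)
    (p : {poly R}) :
  is_interval J -> (forall s, J s -> derivable f s 1) ->
  p != 0 -> (forall s, J s -> root p (f s)) ->
  forall a b, J a -> J b -> f a = f b.
Proof.
move=> Jitv Df p0 pf.
suff lt_cst a b : J a -> J b -> a < b -> f a = f b.
  move=> a b Ja Jb; have [ab|ba|->//] := ltgtP a b; first exact: lt_cst.
  by apply/esym; exact: lt_cst.
move=> Ja Jb ab; apply/eqP/negPn/negP => fab.
have Jab x : a <= x <= b -> J x by exact: Jitv Ja Jb x.
have cf : {within `[a, b], continuous f}.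
  by apply: derivable_within_continuous => x; rewrite in_itv/= => /Jab/Df.
(* Equally spaced points from [f a] towards [f b]: the indices below [size p] give [size p] distinct
   roots, one more than the degree allows. *)
pose v (i : nat) : R := f a + i%:R / (size p)%:R * (f b - f a).
have sp0 : (0 < (size p)%:R :> R) by rewrite ltr0n lt0n size_poly_eq0.
have v_inj : injective v.
  move=> i j /addrI/mulIf; rewrite subr_eq0 eq_sym => /(_ fab).
  by move=> /mulIf; rewrite invr_eq0 gt_eqF// => /(_ isT)/eqP; rewrite eqr_nat => /eqP.
have v_root i : (i < size p)%N -> root p (v i).
  move=> ip; have : Num.min (f a) (f b) <= v i <= Num.max (f a) (f b).
    have t0 : 0 <= i%:R / (size p)%:R :> R by rewrite divr_ge0.
    have t1 : i%:R / (size p)%:R <= 1 :> R.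
      by rewrite ler_pdivrMr// mul1r ler_nat ltnW.
    rewrite /v; set u := _ / _ in t0 t1 *.
    by case: (leP (f a) (f b)) => ?; apply/andP; split; nra.
  move=> /(IVT (ltW ab) cf)[x]; rewrite in_itv/= => /Jab Jx <-.
  exact: pf.
have := @max_poly_roots _ p [seq v i | i <- iota 0 (size p)] p0.
rewrite map_inj_uniq// iota_uniq size_map size_iota ltnn => no_roots.
apply: notF; apply: no_roots => //; apply/allP => x /mapP[i].
by rewrite mem_iota => /andP[_ ip] ->; exact: v_root.
Qed.

(* With [e := e1 e2], the tangential equation integrates to
   [k^2 k'' = (2/5) e k^5 + A], and then to
   [k k'^2 = (1/5) e k^5 - 2 A + B k].  Eliminating the derivatives of [k] from
   [k^5] times the normal equation leaves a polynomial equation on [k] of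
   degree 10, with leading coefficient [- 126 / 25]. *)
Lemma nonvanishing_curvature_cst (R : realType) (J : set R) (k : nat -> R -> R)
    (e1 e2 c : R) :
  open J -> is_interval J -> e1 = 1 \/ e1 = -1 -> e2 = 1 \/ e2 = -1 ->
  (forall i s, J s -> is_derive s 1 (k i) (k i.+1 s)) ->
  (forall s, J s -> k 0 s != 0) ->
  (forall s, J s ->
    k 0 s * k 3 s + 2 * k 1 s * k 2 s - 2 * (e1 * e2) * k 0 s ^+ 3 * k 1 s = 0) ->
  (forall s, J s ->
    k 4 s - 10 * (e1 * e2) * k 0 s ^+ 2 * k 2 s
      - 15 * (e1 * e2) * k 0 s * k 1 s ^+ 2 + k 0 s ^+ 5
      + c * e1 * k 2 s - 2 * c * e2 * k 0 s ^+ 3 = 0) ->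
  forall a b, J a -> J b -> k 0 a = k 0 b.
Proof.
move=> Jopen Jitv e11 e21 Dk k0 tangential normal a b Ja Jb.
pose e := e1 * e2.
have [A AE] : exists A, forall s, J s ->
    k 0 s ^+ 2 * k 2 s = 2 / 5 * e * k 0 s ^+ 5 + A.
  (* The derivative of [f] is [k 0 x] times the left-hand side of the tangential equation. *)
  pose f x := k 0 x ^+ 2 * k 2 x - 2 / 5 * e * k 0 x ^+ 5.
  exists (f a) => s Js.
  rewrite (@derive0_cst_on_interval _ J f Jitv _ a s)//.
    by rewrite /f; ring.
  move=> x Jx.
  have Dkx i := Dk i x Jx; have eqT := tangential x Jx.
  apply: is_derive_eq; rewrite /GRing.scale/=.
  transitivity (k 0 x * 0 : R); last by rewrite mulr0.
  by rewrite -eqT /e; field.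
have [B BE] : exists B, forall s, J s ->
    k 0 s * k 1 s ^+ 2 = 1 / 5 * e * k 0 s ^+ 5 - 2 * A + B * k 0 s.
  (* After division by [k 0 x], the derivative is [2 * k 1 x / k 0 x ^+ 2] times the defect of the
     first integral [AE], hence zero. *)
  pose f x := (k 0 x * k 1 x ^+ 2 - 1 / 5 * e * k 0 x ^+ 5 + 2 * A) * (k 0 x)^-1.
  exists (f a) => s Js.
  rewrite (@derive0_cst_on_interval _ J f Jitv _ a s)//.
    by rewrite /f divfK ?k0//; ring.
  move=> x Jx.
  have Dkx i := Dk i x Jx; have eqA := AE x Jx; have k0x := k0 x Jx.
  have DV := is_deriveV k0x (Dkx 0).
  apply: is_derive_eq; rewrite /GRing.scale/=.
  have -> : A = k 0 x ^+ 2 * k 2 x - 2 / 5 * e * k 0 x ^+ 5 by rewrite eqA; ring.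
  by field.
(* The third derivative is eliminated by taking [k 0 s] times the differentiated tangential equation
   minus [3 * k 1 s] times the equation itself. *)
have D4 s : J s -> k 0 s ^+ 2 * k 4 s =
    6 * k 1 s ^+ 2 * k 2 s - 2 * k 0 s * k 2 s ^+ 2 + 2 * e * k 0 s ^+ 4 * k 2 s.
  move=> Js; have eqT := tangential s Js; have k0s := k0 s Js.
  have Dks i := Dk i s Js.
  pose f x := k 0 x * k 3 x + 2 * k 1 x * k 2 x - 2 * e * k 0 x ^+ 3 * k 1 x.
  have Df : is_derive s 1 f (k 0 s * k 4 s + 3 * k 1 s * k 3 s + 2 * k 2 s ^+ 2
      - 2 * e * (3 * k 0 s ^+ 2 * k 1 s ^+ 2 + k 0 s ^+ 3 * k 2 s)).
    by apply: is_derive_eq; rewrite /GRing.scale/=; ring.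
  have D0 : is_derive s 1 f 0.
    apply: (near_eq_is_derive _ (is_derive_cst (0 : R) s 1)).
    by near do rewrite /f tangential//; exact: open_nbhs_nbhs.
  case: Df => _ Df; case: D0 => _; rewrite Df => eqD.
  apply/eqP; rewrite -subr_eq0; apply/eqP.
  transitivity (k 0 s * 0 - 3 * k 1 s * 0 : R); last by ring.
  rewrite -[X in _ = _ * X - _]eqD -[X in _ = _ - _ * X]eqT -/e; ring.
(* Coefficients are listed by increasing degree. The leading one involves none of [A], [B], [c], so
   [p] is nonzero whatever the integration constants are. *)
pose p : {poly R} := Poly [:: - 14 * A ^+ 2; 6 * A * B; 0; c * e1 * A; 0;
  84 / 5 * e * A; - 63 / 5 * e * B; 0; - 8 / 5 * c * e2; 0; - 126 / 25].
apply: (@root_valued_cst_on_interval _ J (k 0) p) => //.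
- by move=> s /(Dk 0)[].
- apply/eqP => /(congr1 (fun q : {poly R} => q`_10)).
  rewrite coef_Poly/= coef0; lra.
move=> s Js; apply/rootP; rewrite horner_Poly/=.
have := normal s Js; move: (D4 s Js) (AE s Js) (BE s Js) (k0 s Js).
rewrite -/e -(mulrA 15) -/e.
move: (k 0 s) (k 1 s) (k 2 s) (k 4 s) => x x1 x2 x4 eq4 eq2 eq1 x0 eqN.
have x2E : x2 = (2 / 5 * e * x ^+ 5 + A) / x ^+ 2.
  by rewrite -eq2 mulrC mulKf// expf_neq0.
have x1E : x1 ^+ 2 = (1 / 5 * e * x ^+ 5 - 2 * A + B * x) / x.
  by rewrite -eq1 mulrC mulKf.
have x4E : x4 = (6 * x1 ^+ 2 * x2 - 2 * x * x2 ^+ 2 + 2 * e * x ^+ 4 * x2) / x ^+ 2.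
  by rewrite -eq4 mulrC mulKf// expf_neq0.
rewrite -(mulr0 (x ^+ 5)) -[X in _ = _ * X]eqN x4E x1E x2E /e.
(* The identity relies on the squares of the signs being 1, hence the case split. *)
by case: e11 => ->; case: e21 => ->; field.
Unshelve. all: by end_near.
Qed.

(** Zeros of the curvature, possible on an oriented surface, are handled by working with
    [k 0 s ^+ 2], whose derivative vanishes trivially at them. *)
Lemma curvature_cst (R : realType) (J : set R) (k : nat -> R -> R)
    (e1 e2 c : R) :
  open J -> is_interval J -> e1 = 1 \/ e1 = -1 -> e2 = 1 \/ e2 = -1 ->
  (forall i s, J s -> is_derive s 1 (k i) (k i.+1 s)) ->
  (forall s, J s ->
    k 0 s * k 3 s + 2 * k 1 s * k 2 s - 2 * (e1 * e2) * k 0 s ^+ 3 * k 1 s = 0) ->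
  (forall s, J s ->
    k 4 s - 10 * (e1 * e2) * k 0 s ^+ 2 * k 2 s
      - 15 * (e1 * e2) * k 0 s * k 1 s ^+ 2 + k 0 s ^+ 5
      + c * e1 * k 2 s - 2 * c * e2 * k 0 s ^+ 3 = 0) ->
  forall a b, J a -> J b -> k 0 a = k 0 b.
Proof.
move=> Jopen Jitv e11 e21 Dk tangential normal a b Ja Jb.
have k01 s : J s -> k 0 s * k 1 s = 0.
  move=> Js; have [->|k0s] := eqVneq (k 0 s) 0; first by rewrite mul0r.
  (* By continuity, some ball around [s] inside [J] avoids the zeros of [k 0]; balls are open
     intervals, so the previous lemma applies there. *)
  have kcont : {for s, continuous (k 0)}.
    by apply/differentiable_continuous/derivable1_diffP; have [] := Dk 0 s Js.
  have : \forall x \near s, J x /\ k 0 x != 0.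
    near=> x; split; first by near: x; exact: open_nbhs_nbhs.
    by near: x; exact: (cvgr_neq0 _ kcont).
  move=> /nbhs_ballP[r /= r0 rJ].
  have ball_itv : is_interval (ball s r).
    move=> x y; rewrite /ball/= => + + z /andP[xz zy].
    rewrite !ltr_distlC => /andP[sx _] /andP[_ ys].
    by rewrite (lt_le_trans sx xz) (le_lt_trans zy ys).
  have kcst x : ball s r x -> k 0 s = k 0 x.
    move=> sx; apply: (@nonvanishing_curvature_cst _ (ball s r) k e1 e2 c) => //.
    - exact: ball_open.
    - by move=> i y /rJ[+ _]; exact: Dk.
    - by move=> y /rJ[].
    - by move=> y /rJ[+ _]; exact: tangential.
    - by move=> y /rJ[+ _]; exact: normal.
    - exact: ballxx.
  have [_ <-] := Dk 0 s Js.
  have [_ ->] : is_derive s 1 (k 0) 0; last by rewrite mulr0.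
  apply: (near_eq_is_derive _ (is_derive_cst (k 0 s) s 1)).
  by apply/nbhs_ballP; exists r => //= x /kcst.
have k2cst s : J s -> k 0 s ^+ 2 = k 0 a ^+ 2.
  move=> Js; apply: (@derive0_cst_on_interval _ J (fun x => k 0 x ^+ 2)) => // x Jx.
  have Dkx := Dk 0 x Jx; apply: is_derive_eq; rewrite /GRing.scale/=.
  by transitivity (2 * (k 0 x * k 1 x)); [ring|rewrite k01// mulr0].
(* Only the sign of [k 0] is left undetermined; being continuous and valued in the roots of this
   polynomial, [k 0] cannot jump between them. *)
apply: (@root_valued_cst_on_interval _ J (k 0) ('X^2 - (k 0 a ^+ 2)%:P)) => //.
- by move=> s /(Dk 0)[].
- by rewrite monic_neq0// monicXnsubC.
- by move=> s Js; rewrite rootE !hornerE k2cst// subrr.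
Unshelve. all: by end_near.
Qed.

(** * Coordinatewise calculus of vector-valued functions and of the scalar product *)

Lemma is_derive_rowP (R : realType) n (f : R -> 'rV[R]_n) (s : R) (df : 'rV[R]_n) :
  is_derive s 1 f df <->
  forall j, is_derive s 1 (fun x => f x ord0 j) (df ord0 j).
Proof.
split=> [Df j|Df].
  have [/derivable_mxP df1 df2] := Df.
  apply: DeriveDef; first exact: df1.
  by rewrite -df2 derive_mx// mxE.
have df1 : derivable f s 1.
  by apply/derivable_mxP => i j; rewrite (ord1 i); have [] := Df j.
apply: DeriveDef => //; rewrite derive_mx//; apply/rowP => j; rewrite mxE.
by have [] := Df j.
Qed.

Lemma is_derive_scale (R : realType) n (a : R -> R) (f : R -> 'rV[R]_n)
    (s da : R) (df : 'rV[R]_n) :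
  is_derive s 1 a da -> is_derive s 1 f df ->
  is_derive s 1 (fun x => a x *: f x) (da *: f s + a s *: df).
Proof.
move=> Da /is_derive_rowP Df; apply/is_derive_rowP => j.
have Dfj := Df j.
under eq_fun do rewrite mxE.
by apply: is_derive_eq; rewrite /GRing.scale/= !mxE; ring.
Qed.

Lemma sprodC {R : realType} {n} t (x y : 'rV[R]_n) : sprod t x y = sprod t y x.
Proof. by apply: eq_bigr => i _; rewrite mulrAC. Qed.

Lemma sprodDl {R : realType} {n} t (x y z : 'rV[R]_n) :
  sprod t (x + y) z = sprod t x z + sprod t y z.
Proof.
rewrite /sprod -big_split; apply: eq_bigr => i _.
by rewrite mxE mulrDr mulrDl.
Qed.

Lemma sprodZl {R : realType} {n} t (a : R) (x z : 'rV[R]_n) :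
  sprod t (a *: x) z = a * sprod t x z.
Proof.
rewrite /sprod mulr_sumr; apply: eq_bigr => i _.
by rewrite mxE !mulrA (mulrC a).
Qed.

Lemma sprodDr {R : realType} {n} t (x y z : 'rV[R]_n) :
  sprod t z (x + y) = sprod t z x + sprod t z y.
Proof. by rewrite sprodC sprodDl !(sprodC t _ z). Qed.

Lemma sprodZr {R : realType} {n} t (a : R) (x z : 'rV[R]_n) :
  sprod t z (a *: x) = a * sprod t z x.
Proof. by rewrite sprodC sprodZl sprodC. Qed.

Lemma is_derive_sprod {R : realType} {n} t (f h : R -> 'rV[R]_n)
    (s : R) (df dh : 'rV[R]_n) :
  is_derive s 1 f df -> is_derive s 1 h dh ->
  is_derive s 1 (fun x => sprod t (f x) (h x)) (sprod t df (h s) + sprod t (f s) dh).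
Proof.
move=> /is_derive_rowP Df /is_derive_rowP Dh.
have -> : (fun x => sprod t (f x) (h x)) =
    \sum_(i < n) (fun x => (-1) ^+ (i < t)%N * f x ord0 i * h x ord0 i).
  by apply/funext => x; rewrite fct_sumE.
apply: is_derive_eq; rewrite /sprod -big_split; apply: eq_bigr => i _.
by rewrite /GRing.scale/=; ring.
Qed.

(** * Covariant derivatives in the Frenet frame *)

Lemma tangent_projD (R : realType) m t (c : R) (p u v : 'rV[R]_(ambient_dim m c)) :
  tangent_proj t p (u + v) = tangent_proj t p u + tangent_proj t p v.
Proof.
rewrite /tangent_proj; case: ifP => // _.
by rewrite /metric sprodDl mulrDl scalerDl opprD addrACA.
Qed.

Lemma tangent_projZ (R : realType) m t (c a : R) (p v : 'rV[R]_(ambient_dim m c)) :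
  tangent_proj t p (a *: v) = a *: tangent_proj t p v.
Proof.
rewrite /tangent_proj; case: ifP => // _.
by rewrite /metric sprodZl -mulrA -scalerA scalerBr.
Qed.

Lemma tangent_proj_id (R : realType) m t (c : R) (p v : 'rV[R]_(ambient_dim m c)) :
  tangent_at t p v -> tangent_proj t p v = v.
Proof.
rewrite /tangent_proj /tangent_at/=; case: eqP => // _ /(_ isT).
by rewrite /metric sprodC => ->; rewrite mul0r scale0r subr0.
Qed.

(** For nonzero [c], differentiating the constant scalar square of the position vector gives twice
    its product with the velocity. *)
Lemma velocity_tangent (R : realType) m t (c : R) (I : set R)
    (g : R -> 'rV[R]_(ambient_dim m c)) :
  open I -> smooth_on I g -> (forall s, I s -> space_form t (g s)) ->
  forall s, I s -> tangent_at t (g s) (velocity g s).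
Proof.
move=> Iopen gsmooth Ng s Is /= c0.
have Dg : is_derive s 1 g (velocity g s).
  by rewrite /velocity derive1E; apply: derivableP; exact: gsmooth 0 s Is.
have [_] := is_derive_sprod (ambient_index t c) _ _ _ _ _ Dg Dg.
have [_ ->] : is_derive s 1 (fun x => sprod (ambient_index t c) (g x) (g x)) 0.
  apply: (near_eq_is_derive _ (is_derive_cst (c^-1 : R) s 1)).
  have := open_nbhs_nbhs (conj Iopen Is); apply: filterS => x Ix /=.
  by apply/esym; exact: Ng Ix c0.
rewrite /metric sprodC; lra.
Qed.

(** The Leibniz rule gives the flat derivative of [V]; the linear projection then fixes [F1] and
    [F2] and turns their derivatives into the Frenet right-hand sides. The expansion of [V] is
    assumed on all of [I] because it has to be differentiated. *)
Lemma cov_deriv_frame (R : realType) m t (c e1 e2 : R) (I : set R)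
    (g F1 F2 V : R -> 'rV[R]_(ambient_dim m c)) (k a b : R -> R) (s da db : R) :
  open I -> I s ->
  derivable F1 s 1 -> derivable F2 s 1 ->
  tangent_at t (g s) (F1 s) -> tangent_at t (g s) (F2 s) ->
  cov_deriv t g F1 s = (e2 * k s) *: F2 s ->
  cov_deriv t g F2 s = (- e1 * k s) *: F1 s ->
  is_derive s 1 a da -> is_derive s 1 b db ->
  (forall x, I x -> V x = a x *: F1 x + b x *: F2 x) ->
  cov_deriv t g V s =
    (da - e1 * k s * b s) *: F1 s + (db + e2 * k s * a s) *: F2 s.
Proof.
move=> Iopen Is /derivableP DF1 /derivableP DF2 tF1 tF2.
rewrite -derive1E in DF1; rewrite -derive1E in DF2.
rewrite /cov_deriv => cF1 cF2 Da Db VE; rewrite derive1E.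
have VW : \forall x \near s, a x *: F1 x + b x *: F2 x = V x.
  by have := open_nbhs_nbhs (conj Iopen Is); apply: filterS => x /VE.
have DW := is_deriveD (is_derive_scale _ _ _ _ _ _ _ Da DF1)
                      (is_derive_scale _ _ _ _ _ _ _ Db DF2).
have [_ ->] := near_eq_is_derive VW DW.
rewrite !tangent_projD !tangent_projZ cF1 cF2 !tangent_proj_id//.
by apply/rowP => j; rewrite !mxE; ring.
Qed.

(** Here [q i] stands for the derivative of order [i] of the curvature. The frame coordinates of the
    velocity are differentiated covariantly five times, starting from (1, 0). *)
Lemma tau3_frenet (R : realType) m t (c e1 e2 : R) (I : set R)
    (g F2 : R -> 'rV[R]_(ambient_dim m c)) (q : nat -> R -> R) :
  open I -> arc_length_curve t I e1 g -> e2 = 1 \/ e2 = -1 ->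
  (forall s, I s -> derivable F2 s 1) ->
  (forall i s, I s -> is_derive s 1 (q i) (q i.+1 s)) ->
  (forall s, I s ->
     [/\ tangent_at t (g s) (F2 s), metric t (F2 s) (F2 s) = e2
       & metric t (velocity g s) (F2 s) = 0]) ->
  (forall s, I s -> cov_deriv t g (velocity g) s = (e2 * q 0 s) *: F2 s /\
                    cov_deriv t g F2 s = (- e1 * q 0 s) *: velocity g s) ->
  forall s, I s -> tau3 t g s =
    (- 5 * (e1 * e2) * (q 0 s * q 3 s + 2 * q 1 s * q 2 s
       - 2 * (e1 * e2) * q 0 s ^+ 3 * q 1 s)) *: velocity g s +
    (e2 * (q 4 s - 10 * (e1 * e2) * q 0 s ^+ 2 * q 2 s
      - 15 * (e1 * e2) * q 0 s * q 1 s ^+ 2 + q 0 s ^+ 5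
      + c * e1 * q 2 s - 2 * c * e2 * q 0 s ^+ 3)) *: F2 s.
Proof.
move=> I_open [e11 gsmooth Ng F11] e21 F2der Dq F2frame cF.
pose F1 := velocity g.
pose e := e1 * e2.
have step (V : R -> 'rV[R]_(ambient_dim m c)) (a b da db : R -> R) :
    (forall s, I s -> is_derive s 1 a (da s)) ->
    (forall s, I s -> is_derive s 1 b (db s)) ->
    (forall s, I s -> V s = a s *: F1 s + b s *: F2 s) ->
    forall s, I s -> cov_deriv t g V s =
      (da s - e1 * q 0 s * b s) *: F1 s + (db s + e2 * q 0 s * a s) *: F2 s.
  move=> Da Db VE s Is; have [tF2 _ _] := F2frame s Is; have [cF1 cF2] := cF s Is.
  apply: (cov_deriv_frame R m t c e1 e2 I g F1 F2 V (q 0) a b) => //.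
  - exact: gsmooth 1 s Is.
  - exact: F2der s Is.
  - exact: velocity_tangent I_open gsmooth Ng s Is.
  - exact: Da.
  - exact: Db.
have D0 s : I s -> cov_deriv_velocity t 0 g s = 1 *: F1 s + 0 *: F2 s.
  by rewrite scale1r scale0r addr0.
have D1 s : I s -> cov_deriv_velocity t 1 g s = 0 *: F1 s + (e2 * q 0 s) *: F2 s.
  move=> Is; apply: (etrans (step _ (fun=> 1) (fun=> 0) (fun=> 0) (fun=> 0) _ _ D0 s Is)).
  by congr (_ *: _ + _ *: _); ring.
have D2 s : I s -> cov_deriv_velocity t 2 g s =
    (- e * q 0 s ^+ 2) *: F1 s + (e2 * q 1 s) *: F2 s.
  move=> Is.
  apply: (etrans (step _ _ _ (fun=> 0) (fun s => e2 * q 1 s) _ _ D1 s Is)).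
    move=> x Ix; have Dqx i := Dq i x Ix.
    by apply: is_derive_eq; rewrite /GRing.scale/=; ring.
  by congr (_ *: _ + _ *: _); rewrite /e; ring.
have D3 s : I s -> cov_deriv_velocity t 3 g s =
    (- 3 * e * q 0 s * q 1 s) *: F1 s + (e2 * (q 2 s - e * q 0 s ^+ 3)) *: F2 s.
  move=> Is.
  apply: (etrans (step _ _ _ (fun s => - e * 2 * q 0 s * q 1 s)
                             (fun s => e2 * q 2 s) _ _ D2 s Is)).
  - move=> x Ix; have Dqx i := Dq i x Ix.
    by apply: is_derive_eq; rewrite /GRing.scale/=; ring.
  - move=> x Ix; have Dqx i := Dq i x Ix.
    by apply: is_derive_eq; rewrite /GRing.scale/=; ring.
  - by congr (_ *: _ + _ *: _); rewrite /e; ring.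
have D4 s : I s -> cov_deriv_velocity t 4 g s =
    (- 3 * e * q 1 s ^+ 2 - 4 * e * q 0 s * q 2 s + q 0 s ^+ 4) *: F1 s +
    (e2 * (q 3 s - 6 * e * q 0 s ^+ 2 * q 1 s)) *: F2 s.
  move=> Is.
  apply: (etrans (step _ _ _ (fun s => - 3 * e * (q 1 s ^+ 2 + q 0 s * q 2 s))
    (fun s => e2 * (q 3 s - 3 * e * q 0 s ^+ 2 * q 1 s)) _ _ D3 s Is)).
  - move=> x Ix; have Dqx i := Dq i x Ix.
    by apply: is_derive_eq; rewrite /GRing.scale/=; ring.
  - move=> x Ix; have Dqx i := Dq i x Ix.
    by apply: is_derive_eq; rewrite /GRing.scale/=; ring.
  (* From here on [e ^+ 2] appears, and the case split on signs replaces it by 1. *)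
  - congr (_ *: _ + _ *: _); rewrite /e.
      by case: e11 => ->; case: e21 => ->; ring.
    by case: e11 => ->; case: e21 => ->; ring.
have D5 s : I s -> cov_deriv_velocity t 5 g s =
    (- 5 * e * q 0 s * q 3 s - 10 * e * q 1 s * q 2 s
      + 10 * q 0 s ^+ 3 * q 1 s) *: F1 s +
    (e2 * (q 4 s - 15 * e * q 0 s * q 1 s ^+ 2 - 10 * e * q 0 s ^+ 2 * q 2 s
      + q 0 s ^+ 5)) *: F2 s.
  move=> Is.
  apply: (etrans (step _ _ _
    (fun s => - 10 * e * q 1 s * q 2 s - 4 * e * q 0 s * q 3 s + 4 * q 0 s ^+ 3 * q 1 s)
    (fun s => e2 * (q 4 s - 12 * e * q 0 s * q 1 s ^+ 2 - 6 * e * q 0 s ^+ 2 * q 2 s))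
    _ _ D4 s Is)).
  - move=> x Ix; have Dqx i := Dq i x Ix.
    by apply: is_derive_eq; rewrite /GRing.scale/=; ring.
  - move=> x Ix; have Dqx i := Dq i x Ix.
    by apply: is_derive_eq; rewrite /GRing.scale/=; ring.
  - congr (_ *: _ + _ *: _); rewrite /e.
      by case: e11 => ->; case: e21 => ->; ring.
    by case: e11 => ->; case: e21 => ->; ring.
move=> s Is; have [_ F22 F12] := F2frame s Is.
have F11s := F11 s Is; have F21 : metric t (F2 s) (F1 s) = 0 by rewrite /metric sprodC.
(* Both curvature terms turn out to be multiples of [F2 s], so [c] enters the normal component
   only. *)
rewrite /tau3 D0// D1// D2// D3// D5// /curvature_tensor /metric.
rewrite !(sprodDl, sprodDr, sprodZl, sprodZr).
rewrite /metric -/F1 in F11s F22 F12 F21; rewrite F11s F22 F12 F21 -/F1.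
apply/rowP => j; rewrite !mxE /e.
by case: e11 => ->; case: e21 => ->; ring.
Qed.

(** * Triharmonicity read off in the frame *)

Theorem theorem1p8 (R : realType) (m t : nat) (c : R)
    (hm : (2 <= m)%N) (ht : (1 <= t <= m - 1)%N)
    (o : bool) (I : set R) (I_open : open I) (I_itv : is_interval I)
    (e1 e2 : R) (g F2 : R -> 'rV[R]_(ambient_dim m c)) (k : R -> R)
    (g_frenet : two_frenet_curve t c o I e1 e2 g F2 k)
    (g_triharmonic : triharmonic t c I g) :
  exists k0 : R, forall s : R, I s -> k s = k0.
Proof.
case: g_frenet => -[arc e21] [F2smooth ksmooth] F2frame cF _.
have [e11 _ _ F11] := arc.
have [[a Ia]|I0] := pselect (exists s, I s); last first.
  by exists 0 => s Is; case: I0; exists s.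
pose q i : R -> R := derive1n i (k : R -> R^o).
have Dq i s : I s -> is_derive s 1 (q i) (q i.+1 s).
  by move=> /(ksmooth i)/derivableP; rewrite -derive1E.
have tauE := @tau3_frenet R m t c e1 e2 I g F2 q I_open arc e21
  (F2smooth 0) Dq F2frame cF.
have e1_neq0 : e1 != 0 by case: e11 => ->; rewrite ?oppr_eq0 oner_neq0.
have e2_neq0 : e2 != 0 by case: e21 => ->; rewrite ?oppr_eq0 oner_neq0.
(* The frame is orthogonal with nonnull vectors, so pairing with each of them isolates one
   coefficient, even in an indefinite metric. *)
have frame_free s x y : I s -> x *: velocity g s + y *: F2 s = 0 -> x = 0 /\ y = 0.
  move=> Is xy0; have [_ F22 F12] := F2frame s Is; have F11s := F11 s Is.
  have metric0 w : metric t (x *: velocity g s + y *: F2 s) w = 0.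
    by rewrite xy0 /metric -(scale0r w) sprodZl mul0r.
  move: (metric0 (velocity g s)) (metric0 (F2 s)).
  rewrite /metric !(sprodDl, sprodZl) (sprodC _ (F2 s) (velocity g s)).
  rewrite -!/(metric t _ _) F11s F22 F12 !mulr0 addr0 add0r.
  by move=> /eqP + /eqP; rewrite !mulf_eq0 (negPf e1_neq0) (negPf e2_neq0) !orbF
    => /eqP + /eqP.
exists (k a) => s Is.
apply: (@curvature_cst R I q e1 e2 c) => // x Ix.
  (* The tangential coefficient carries the factor [- 5 * (e1 * e2)], which is cancelled; below, the
     normal one carries [e2]. *)
  have [/eqP + _] := frame_free x _ _ Ix (etrans (esym (tauE x Ix)) (g_triharmonic x Ix)).
  rewrite !mulf_eq0 oppr_eq0 pnatr_eq0/= (negPf e1_neq0) (negPf e2_neq0)/=.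
  by move=> /eqP.
have [_ /eqP] := frame_free x _ _ Ix (etrans (esym (tauE x Ix)) (g_triharmonic x Ix)).
by rewrite mulf_eq0 (negPf e2_neq0)/= => /eqP.
Qed.
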